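(* For all integers $1\le j\le n$ and all $k$, $$B_{n,k}^{(j)}(q)=\sum_{\substack{\pi\in\bar{\mathfrak{S}}_n^{(j)}\\ \mathrm{lec}(\pi)=k}}q^{\mathrm{inv}(\pi)-\mathrm{lec}(\pi)},$$ where $B_{n,k}^{(j)}(q)$ denotes the restricted $q$-Eulerian numbers.
   Context: Notation: $(q;q)_n=\prod_{i=1}^n(1-q^i)$, $(q;q)_0=1$; $e(z;q)=\sum_{n\ge 0}\frac{z^n}{(q;q)_n}$. All generating functions are formal power series in $z$. The $(q,r)$-Eulerian polynomials $A_n(t,r,q)$, $n\ge 0$, are defined by $$\sum_{n\ge 0}A_n(t,r,q)\frac{z^n}{(q;q)_n}=\frac{(1-t)e(rz;q)}{e(tz;q)-te(z;q)},$$ and $A_n(t,q):=A_n(t,1,q)$. For $1\le j\le n$ the restricted $q$-Eulerian polynomials $B_n^{(j)}(t,q)$ are defined by $$\sum_{n\ge j}B_n^{(j)}(t,q)\frac{z^{n-1}}{(q;q)_{n-1}}=\left(\frac{A_{j-1}(t,q)(qz)^{j-1}}{(q;q)_{j-1}}\right)\frac{e(tz;q)-te(tz;q)}{e(tz;q)-te(z;q)},$$ and the restricted $q$-Eulerian numbers by $B_n^{(j)}(t,q)=\sum_k B_{n,k}^{(j)}(q)t^k$. Hook factorization: a word $w=w_1\cdots w_m$ over $\mathbb{N}$ is a hook if $w_1>w_2$ and either $m=2$, or $m\ge 3$ and $w_2<w_3<\cdots<w_m$. Each permutation $\pi$ of a finite set of positive integers, written as a word, has a unique factorization (its hook factorization)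 $\pi=p\tau_1\tau_2\cdots\tau_r$ with $r\geq 0$, $p$ a (possibly empty) increasing word and each $\tau_i$ a hook. $\mathrm{inv}(w)$ is the number of inversions of a word $w$ (pairs of positions $i<j$ with $w_i>w_j$), and $\mathrm{lec}(\pi)=\sum_{i=1}^r\mathrm{inv}(\tau_i)$. For a finite set $X$, $\mathfrak{S}_X$ is the set of permutations of $X$ (words using each letter of $X$ once), and $\mathfrak{S}_n=\mathfrak{S}_{[n]}$. Define $\bar{\mathfrak{S}}_n^{(j)}=\{\pi\in\mathfrak{S}_n:\pi(j+1)=1\}$ for $1\le j<n$, and $\bar{\mathfrak{S}}_n^{(n)}=\{\pi'\square 1:\pi'\in\mathfrak{S}_{[n]\setminus\{1\}}\}$, where $\square$ is a formal symbol marking that the $n$-th position is empty (and $1$ sits in position $n+1$). For $\pi=\pi_1\cdots\pi_{n-1}\square 1\in\bar{\mathfrak{S}}_n^{(n)}$ set $\mathrm{lec}(\pi):=\mathrm{lec}(\pi_1\cdots\pi_{n-1})$ and $\mathrm{inv}(\pi):=\mathrm{inv}(\pi_1\cdots\pi_{n-1}1)$. *)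

(* Defs.v *)
From HB Require Import structures.
From mathcomp Require Import all_boot all_order all_algebra.

Set Implicit Arguments.
Unset Strict Implicit.
Unset Printing Implicit Defensive.

Import GRing.Theory.
Local Open Scope ring_scope.

(* A formal power series sum_n a_n z^n over F is its coefficient sequence
   a : nat -> F. *)
Section PowerSeries.
Variable F : fieldType.
Implicit Types a b : nat -> F.

Definition fps_mul a b (n : nat) : F := \sum_(i < n.+1) a i * b (n - i)%N.

Fixpoint fps_div_prefix a b (n : nat) : seq F :=
  if n is m.+1 then
    let c := fps_div_prefix a b m in
    rcons c ((a m - \sum_(i < m) c`_i * b (m - i)%N) / b 0%N)
  else [::].

(* The quotient a / b, meaningful when b 0 != 0; see fps_divK. *)
Definition fps_div a b (n : nat) : F := (fps_div_prefix a b n.+1)`_n.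

Lemma size_fps_div_prefix a b n : size (fps_div_prefix a b n) = n.
Proof. by elim: n => //= n IH; rewrite size_rcons IH. Qed.

Lemma nth_fps_div_prefix a b n i :
  (i < n)%N -> (fps_div_prefix a b n)`_i = fps_div a b i.
Proof.
elim: n => // n IH; rewrite ltnS leq_eqVlt => /orP[/eqP-> //|lt_in].
by rewrite -IH //= nth_rcons size_fps_div_prefix lt_in.
Qed.

Lemma fps_divE a b n :
  fps_div a b n = (a n - \sum_(i < n) fps_div a b i * b (n - i)%N) / b 0%N.
Proof.
rewrite {1}/fps_div /= nth_rcons size_fps_div_prefix ltnn eqxx.
congr ((_ - _) / _); apply: eq_bigr => i _.
by rewrite nth_fps_div_prefix.
Qed.

Lemma fps_divK a b : b 0%N != 0 -> fps_mul (fps_div a b) b =1 a.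
Proof.
move=> b0 n; rewrite /fps_mul big_ord_recr /= subnn [fps_div a b n]fps_divE.
by rewrite divfK // addrC subrK.
Qed.

End PowerSeries.

(* The generating functions make sense for elements q, t, r of any field in
   which 1 - t and all the (q;q)_n are nonzero; they are specialized to
   indeterminates below. *)
Section Eulerian.
Variable F : fieldType.
Implicit Types q t r a : F.

Definition qpoch q (n : nat) : F := \prod_(1 <= i < n.+1) (1 - q ^+ i).

(* e(a z; q) as a power series in z. *)
Definition qexp q a (n : nat) : F := a ^+ n / qpoch q n.

(* e(tz;q) - t e(z;q) *)
Definition eulerian_den q t (n : nat) : F := qexp q t n - t * qexp q 1 n.

(* A_n(t,r,q) *)
Definition qr_eulerian q t r (n : nat) : F :=
  qpoch q n *
  fps_div (fun m => (1 - t) * qexp q r m) (eulerian_den q t) n.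

(* A_n(t,q) *)
Definition q_eulerian q t (n : nat) : F := qr_eulerian q t 1 n.

Definition restr_eulerian_series q t (j : nat) : nat -> F :=
  fps_mul
    (fun m => if m == j.-1
              then q_eulerian q t j.-1 * q ^+ j.-1 / qpoch q j.-1 else 0)
    (fps_div (fun m => qexp q t m - t * qexp q t m) (eulerian_den q t)).

(* B_n^{(j)}(t,q), for 1 <= j <= n *)
Definition restr_eulerian q t (n j : nat) : F :=
  qpoch q n.-1 * restr_eulerian_series q t j n.-1.

Lemma qr_eulerian_gf q t r :
  1 - t != 0 -> (forall n, qpoch q n != 0) ->
  fps_mul (fun n => qr_eulerian q t r n / qpoch q n) (eulerian_den q t)
    =1 (fun n => (1 - t) * qexp q r n).
Proof.
move=> t1 q0 n.
have den0 : eulerian_den q t 0%N != 0.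
  by rewrite /eulerian_den /qexp /qpoch big_geq // !expr0 invr1 !mulr1.
rewrite -[RHS](fps_divK (fun m => (1 - t) * qexp q r m) den0).
apply: eq_bigr => i _; congr (_ * _).
by rewrite /qr_eulerian mulrAC mulfV // mul1r.
Qed.

End Eulerian.

(* Q(q), and Q(q)(t), which contains q and t as independent indeterminates. *)
Definition Qq : fieldType := {fraction {poly rat}}.
Definition Qqt : fieldType := {fraction {poly Qq}}.
Definition q_var : Qq := tofrac 'X.
Definition q_in_Qqt : Qqt := tofrac q_var%:P.
Definition t_var : Qqt := tofrac 'X.

Lemma one_sub_t_var_neq0 : 1 - t_var != 0.
Proof.
rewrite -[1](rmorph1 (@tofrac {poly Qq})) -rmorphB tofrac_eq0 -opprB oppr_eq0.
by rewrite polyXsubC_eq0.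
Qed.

Lemma qpoch_q_in_Qqt_neq0 n : qpoch q_in_Qqt n != 0.
Proof.
rewrite prodf_seq_neq0; apply/allP => i; rewrite mem_index_iota => /andP[i0 _].
rewrite /= /q_in_Qqt /q_var.
rewrite -[1](rmorph1 (@tofrac {poly Qq})) -!rmorphXn -rmorphB tofrac_eq0 /=.
rewrite -[1](rmorph1 (@polyC Qq)) -rmorphB polyC_eq0.
rewrite -[1](rmorph1 (@tofrac {poly rat})) -rmorphB tofrac_eq0 -opprB oppr_eq0.
by rewrite -size_poly_eq0 size_XnsubC.
Qed.

(* The polynomial p such that f = p / 1, and 0 if there is none; see tofracK
   and poly_of_fracK. *)
Definition poly_of_frac (K : fieldType) (f : {fraction {poly K}}) : {poly K} :=
  let p := \n_(repr f) %/ \d_(repr f) in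
  if tofrac p == f then p else 0.

Lemma tofracK (K : fieldType) : cancel (@tofrac {poly K}) (@poly_of_frac K).
Proof.
move=> p; rewrite /poly_of_frac.
set f := tofrac p; set d := \d_(repr f).
have d0 : d != 0 by apply: denom_ratioP.
have -> : \n_(repr f) %/ d = p; last by rewrite eqxx.
suff -> : \n_(repr f) = p * d by rewrite mulpK.
have := FracField.equivf_l (Ratio p 1).
rewrite !numden_Ratio ?oner_neq0 // mulr1 mulrC.
by rewrite /d /f /tofrac; unlock => ->; rewrite mulrC.
Qed.

Lemma poly_of_fracK (K : fieldType) (f : {fraction {poly K}}) :
  (exists p, f = tofrac p) -> tofrac (poly_of_frac f) = f.
Proof. by case=> p ->; rewrite tofracK. Qed.

(* B_{n,k}^{(j)}(q), the coefficient of t^k in B_n^{(j)}(t,q). *)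
Definition restr_eulerian_num (n j k : nat) : Qq :=
  (poly_of_frac (restr_eulerian q_in_Qqt t_var n j))`_k.

Definition inv (w : seq nat) : nat :=
  #|[set ij : 'I_(size w) * 'I_(size w)
      | (ij.1 < ij.2)%N && (nth 0%N w ij.2 < nth 0%N w ij.1)%N]|.

Definition is_hook (w : seq nat) : bool :=
  if w is x :: y :: s then (y < x)%N && path ltn y s else false.

Definition is_hook_factorization (w p : seq nat) (taus : seq (seq nat)) : bool :=
  [&& w == p ++ flatten taus, sorted ltn p & all is_hook taus].

(* Computed from right to left: a letter put before a nonempty increasing
   prefix p either extends p or turns it into a hook.  Existence and uniqueness
   are hook_factorizationP and hook_factorization_uniq. *)
Fixpoint hook_factorization (w : seq nat) : seq nat * seq (seq nat) :=
  if w is x :: w' then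
    let: (p, taus) := hook_factorization w' in
    if p is y :: _ then
      if (y < x)%N then ([::], (x :: p) :: taus) else (x :: p, taus)
    else ([:: x], taus)
  else ([::], [::]).

Definition lec (w : seq nat) : nat :=
  \sum_(tau <- (hook_factorization w).2) inv tau.

Lemma hook_factorizationP (w : seq nat) : uniq w ->
  is_hook_factorization w (hook_factorization w).1 (hook_factorization w).2.
Proof.
elim: w => //= x w IH /andP[xw /IH{IH}]; rewrite /is_hook_factorization.
case: (hook_factorization w) => -[|y p] taus /and3P[/eqP Ew pp hh].
  by move: hh => /= ->; rewrite Ew eqxx.
move: Ew pp hh => /= Ew pp hh; case: ltnP => [lt_yx|].
  by rewrite /= Ew lt_yx pp hh eqxx.
rewrite leq_eqVlt => /orP[/eqP exy|lt_xy]; last by rewrite /= Ew lt_xy pp hh eqxx.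
by rewrite Ew exy mem_head in xw.
Qed.

Lemma hook_factorization_uniq (w p : seq nat) (taus : seq (seq nat)) :
  is_hook_factorization w p taus -> hook_factorization w = (p, taus).
Proof.
elim: w p taus => [|x w IH] p taus /and3P[/eqP Ew pp hh].
  case: p Ew pp => // Ew _; case: taus Ew hh => // -[|? [|? ?]] //.
case: p Ew pp => [|x' p].
  case: taus hh => // -[|x' [|y s]] // taus /= /andP[/andP[lt_yx ps] hh].
  move=> [Ex Ew] _; subst x'.
  rewrite (IH (y :: s) taus) ?lt_yx //.
  by rewrite /is_hook_factorization Ew eqxx /= ps hh.
move=> [Ex Ew] pp; subst x' => /=.
rewrite (IH p taus); last by rewrite /is_hook_factorization Ew eqxx hh (path_sorted pp).
by case: p pp {Ew} => //= y p /andP[lt_xy _]; rewrite ltnNge ltnW.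
Qed.

Lemma inv_cons (x : nat) (w : seq nat) :
  inv (x :: w) = (count (fun y => y < x) w + inv w)%N.
Proof.
have invE v : inv v =
  (\sum_(i < size v) \sum_(j < size v) ((i < j) && (nth 0 v j < nth 0 v i)))%N.
  by rewrite /inv cardsE -sum1_card big_mkcond pair_bigA.
rewrite !invE /= big_ord_recl /= big_ord_recl /= add0n; congr (_ + _)%N.
  rewrite -sum1_count [RHS]big_mkcond (big_nth 0%N) big_mkord.
  by apply: eq_bigr => i _; case: ifP.
by apply: eq_bigr => i _; rewrite big_ord_recl.
Qed.

Lemma inv_cat (u v : seq nat) : (inv u + inv v <= inv (u ++ v))%N.
Proof.
elim: u => [|x u IH] /=.
  suff -> : inv [::] = 0%N by [].
  by apply/eqP; rewrite cards_eq0; apply/eqP/setP=> -[[]].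
rewrite !inv_cons count_cat -!addnA leq_add2l (leq_trans IH) //.
by rewrite leq_addl.
Qed.

Lemma lec_leq_inv (w : seq nat) : uniq w -> (lec w <= inv w)%N.
Proof.
move=> /hook_factorizationP /and3P[/eqP Ew _ _].
rewrite {2}Ew /lec; move: (hook_factorization w) => -[p taus] /=.
apply: (@leq_trans (inv (flatten taus))).
  elim: taus {Ew} => [|u taus IH] /=; first by rewrite big_nil.
  by rewrite big_cons (leq_trans _ (inv_cat _ _)) // leq_add2l.
by rewrite (leq_trans _ (inv_cat _ _)) // leq_addl.
Qed.

(* Elements of the sets \bar S_n^{(j)}: [Plain w] is an ordinary word w,
   [Boxed w] is the word w [] 1 with an empty position before the final 1. *)
Inductive bword : Type := Plain of seq nat | Boxed of seq nat.

Definition lec_bword (b : bword) : nat :=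
  match b with Plain w => lec w | Boxed w => lec w end.

Definition inv_bword (b : bword) : nat :=
  match b with Plain w => inv w | Boxed w => inv (rcons w 1%N) end.

(* A duplicate-free enumeration of \bar S_n^{(j)}, 1 <= j <= n.  The word of pi
   in S_n is pi(1) ... pi(n), so pi(j+1) is its letter of 0-based index j. *)
Definition barS (n j : nat) : seq bword :=
  if (j < n)%N then
    [seq Plain w | w <- permutations (iota 1 n) & nth 0%N w j == 1%N]
  else [seq Boxed w | w <- permutations (iota 2 n.-1)].

Lemma lec_leq_inv_barS (n j : nat) :
  all (fun b => lec_bword b <= inv_bword b)%N (barS n j).
Proof.
rewrite /barS; case: ifP => _; rewrite all_map; apply/allP => w /=.
  rewrite mem_filter mem_permutations => /andP[_ /perm_uniq Ew].
  by rewrite lec_leq_inv // Ew iota_uniq.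
rewrite mem_permutations => /perm_uniq Ew.
rewrite (@leq_trans (inv w)) ?lec_leq_inv ?Ew ?iota_uniq // -cats1.
by rewrite (leq_trans _ (inv_cat _ _)) // leq_addr.
Qed.

(* Main.v *)
Require Import Defs.
From mathcomp Require Import all_boot all_order all_algebra.
From mathcomp Require Import ring.
Import Defs GRing.Theory.
Local Open Scope ring_scope.
Set Implicit Arguments.
Unset Strict Implicit.
Unset Printing Implicit Defensive.

(** Give a word w the weight q^inv(w) f(w) and put u = t/q, so that u^lec(w)
    turns q^inv(w) into t^lec(w) q^(inv(w) - lec(w)).  If f only depends on the
    relative order of the letters, the sums of these weights over the
    permutations of {0, ..., n-1}, divided by (q;q)_n, are the coefficients of a
    power series G(f).  Cutting a word at a fixed place makes its two halves
    independent: the sum factors, up to a q-binomial coefficient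
    (wsum_splitE).  Hence G maps concatenation products of functions on words
    to products of power series (qegf_wconv).

    Hook factorizations are unique, so they are identities between functions on
    words.  Let H be u^lec on the words that are products of hooks, and 0 on
    the other words.  Then
    - H = 1 + hook * H (hooks_wtE), where 1 is the indicator of the empty word,
      and there is one hook on n letters for each of the inversion numbers
      1, ..., n-1, so that G(H) = (1-t) / (e(tz) - t e(z)) (qegf_hooks_den);
    - u^lec = increasing * H (lec_wtE), whence G(u^lec) = e(z) G(H) is the
      generating function of the A_n(t,q) / (q;q)_n (q_eulerian_lec).

    Now let 1 follow the letter x in pi = alpha x 1 beta, where x is the j-th
    letter, and let p be the increasing prefix of the hook factorization of
    beta.  The hook factorization of pi is that of alpha, then the hook x 1 p,
    then the hooks of beta.  So, once the letter 1 is erased, the weight of pi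
    is q^inv of the remaining word, times q^(j-1), times u^lec of alpha, times a
    weight of x beta (barS_wsum), which is the value at x beta of 1 + K * H.
    Here K sends x p, with p increasing, to t u^inv(x p), and other words to 0;
    the term 1 accounts for j = n, when there is no x beta.  There is one word
    x p on n letters with p increasing for each first letter, so G(K) has the
    coefficients (t + ... + t^n) / (q;q)_n; this gives
    1 + G(K) G(H) = (1-t) e(tz) / (e(tz) - t e(z)) (suffix_series), the second
    factor in the definition of the restricted polynomials.  Cutting the words
    after alpha concludes (restr_eulerianE). *)

(** * Inversions of a concatenation, and invariance under relabelling *)

Definition cross (u v : seq nat) : nat :=
  (\sum_(x <- u) count (fun y => y < x) v)%N.

Lemma inv_nil : inv [::] = 0%N.
Proof. by apply/eqP; rewrite cards_eq0; apply/eqP/setP=> -[[]]. Qed.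

Lemma inv_catE u v : inv (u ++ v) = (cross u v + (inv u + inv v))%N.
Proof.
elim: u => [|x u IH]; first by rewrite /cross big_nil inv_nil.
rewrite cat_cons !inv_cons IH count_cat /cross big_cons.
by rewrite [(count _ u + _)%N]addnC addnACA !addnA.
Qed.

Lemma cross_perm u u' v v' : perm_eq u u' -> perm_eq v v' ->
  cross u v = cross u' v'.
Proof.
move=> /(perm_big _) uu vv; rewrite /cross uu.
by apply: eq_bigr => x _; apply: (permP vv).
Qed.

Lemma inv_sorted w : sorted ltn w -> inv w = 0%N.
Proof.
elim: w => [|x w IH] sw; first exact: inv_nil.
rewrite inv_cons IH ?(path_sorted sw) // addn0; apply/eqP.
rewrite -leqn0 leqNgt -has_count; apply/hasPn => y yw.
by rewrite -leqNgt ltnW //; have /allP := order_path_min ltn_trans sw; apply.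
Qed.

Definition mono_nat (g : nat -> nat) := {mono g : x y / (x < y)%N}.

Definition order_inv (T : Type) (f : seq nat -> T) :=
  forall g, mono_nat g -> forall w, f (map g w) = f w.

Lemma mono_nat_inj g : mono_nat g -> injective g.
Proof.
move=> mg x y exy; apply/eqP; rewrite eqn_leq.
by rewrite leqNgt -mg exy ltnn leqNgt -mg exy ltnn.
Qed.

Lemma inv_order_inv : order_inv inv.
Proof.
move=> g mg; elim=> //= x w IH; rewrite !inv_cons IH count_map; congr addn.
by apply: eq_count => y /=; rewrite mg.
Qed.

(** An increasing word is the image of an initial segment under a map that is
    increasing on all of nat, as order_inv requires. *)
Lemma sorted_as_map X : sorted ltn X ->
  exists2 g, mono_nat g & X = map g (iota 0 (size X)).
Proof.
(* Past the end of X the default value keeps g increasing. *)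
move=> sX; pose g i := nth (foldr maxn 0 X + i).+1%N X i; exists g; last first.
  apply: (@eq_from_nth _ 0%N) => [|i iX]; first by rewrite size_map size_iota.
  rewrite (nth_map 0%N) ?size_iota // nth_iota //= /g.
  exact: set_nth_default.
have ub i x : x \in X -> (x <= foldr maxn 0 X + i)%N.
  elim: X {sX g} => //= y X IH; rewrite inE => /orP[/eqP->|/IH {}IH].
    by rewrite addn_maxl leq_max leq_addr.
  by rewrite addn_maxl leq_max IH orbT.
have g_lt i k : (i < k)%N -> (g i < g k)%N.
  move=> ik; rewrite /g; case: (ltnP k (size X)) => kX.
    have iX := ltn_trans ik kX.
    rewrite !(set_nth_default 0%N) // (sorted_ltn_nth ltn_trans) //.
  rewrite (nth_default _ kX); case: (ltnP i (size X)) => iX.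
    by rewrite ltnS ub // mem_nth.
  by rewrite nth_default // ltnS -addnS leq_add2l.
move=> i k; apply/idP/idP; last exact: g_lt.
by apply: contraTT; rewrite -!leqNgt leq_eqVlt => /orP[/eqP->//|/g_lt/ltnW].
Qed.

Lemma perm_permutations_map (g : nat -> nat) (X : seq nat) : injective g -> uniq X ->
  perm_eq (permutations (map g X)) (map (map g) (permutations X)).
Proof.
move=> gi uX; apply: uniq_perm; first exact: permutations_uniq.
  by rewrite (map_inj_uniq (inj_map gi)) permutations_uniq.
have u2 : uniq (map (map g) (permutations X)).
  by rewrite (map_inj_uniq (inj_map gi)) permutations_uniq.
have sub : {subset map (map g) (permutations X) <= permutations (map g X)}.
  by move=> _ /mapP[w wX ->]; rewrite mem_permutations perm_map // -mem_permutations.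
have le : (size (permutations (map g X)) <= size (map (map g) (permutations X)))%N.
  by rewrite size_map !size_permutations ?map_inj_uniq // size_map.
by move=> w; have [_ ->] := uniq_min_size u2 sub le.
Qed.

(** * Sums over the permutations of a set of letters *)

Lemma mem_map_mask (T : eqType) (m : bitseq) (X : seq T) : uniq X ->
  size m = size X -> map (fun x => x \in mask m X) X = m.
Proof.
elim: X m => [|x X IH] [|b m] //= /andP[xX uX] [sm].
rewrite -[in RHS](IH m uX sm); case: b => /=; last first.
  congr cons; apply/negbTE; by apply: contra xX => /mem_mask.
rewrite inE eqxx; congr cons; apply/eq_in_map => y yX /=.
rewrite inE; case: eqP => // eyx; by rewrite -eyx yX in xX.
Qed.

Section WordSums.
Variables (F : fieldType) (q : F).
Implicit Types (f phi psi : seq nat -> F) (X u v w : seq nat).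

Definition wsum f X : F := \sum_(w <- permutations X) q ^+ inv w * f w.

Lemma eq_wsum f f' X : uniq X ->
  (forall w, uniq w -> perm_eq w X -> f w = f' w) -> wsum f X = wsum f' X.
Proof.
move=> uX ff; rewrite /wsum big_seq [RHS]big_seq; apply: eq_bigr => w.
rewrite mem_permutations => wX; rewrite ff //.
by rewrite (perm_uniq wX).
Qed.

Lemma wsum_iota f X : order_inv f -> sorted ltn X ->
  wsum f X = wsum f (iota 0 (size X)).
Proof.
move=> fi /sorted_as_map[g mg {1}->].
rewrite /wsum (perm_big _ (perm_permutations_map (mono_nat_inj mg) (iota_uniq _ _))).
by rewrite big_map; apply: eq_bigr => w _; rewrite fi // inv_order_inv.
Qed.

Lemma wsum_cons f X : uniq X -> (0 < size X)%N ->
  wsum f X = \sum_(x <- X)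
    q ^+ count (fun y => y < x)%N X * wsum (fun w => f (x :: w)) (rem x X).
Proof.
move=> uX X0; rewrite /wsum (perm_big _ (permutationsE X0)) undup_id //.
rewrite (big_allpairs_dep (r2 := fun x => permutations (rem x X))).
rewrite big_seq [RHS]big_seq; apply: eq_bigr => x xX; rewrite mulr_sumr.
rewrite big_seq [RHS]big_seq; apply: eq_bigr => w; rewrite mem_permutations => wX.
rewrite inv_cons exprD !mulrA; congr (q ^+ _ * _ * _).
rewrite (permP wX) (permP (perm_to_rem xX)) /=.
by rewrite ltnn.
Qed.

(** A permutation of X is determined by the set m of the letters among its
    first a, an ordering of these letters, and an ordering of the others. *)
Lemma big_permutations_split X a (G : seq nat -> seq nat -> F) :
  uniq X -> (a <= size X)%N ->
  \sum_(w <- permutations X) G (take a w) (drop a w) =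
  \sum_(m : (size X).-tuple bool | count id m == a)
    \sum_(u <- permutations (mask m X))
      \sum_(v <- permutations (mask (map negb m) X)) G u v.
Proof.
move=> uX aX.
pose mk (w : seq nat) := map_tuple (fun x => x \in take a w) (in_tuple X).
(* The set of the first a letters, listed in the order of X. *)
have filt w : perm_eq w X -> perm_eq (take a w) (filter (fun x => x \in take a w) X).
  move=> wX; apply: uniq_perm; rewrite ?filter_uniq ?take_uniq ?(perm_uniq wX) //.
  move=> x; rewrite mem_filter /= -(perm_mem wX).
  by case: (boolP (x \in take a w)) => //= /mem_take.
have filtC w : perm_eq w X ->
    perm_eq (drop a w) (filter (predC (fun x => x \in take a w)) X).
  move=> wX; have uw : uniq w by rewrite (perm_uniq wX).
  apply: uniq_perm; rewrite ?filter_uniq ?drop_uniq //.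
  move=> x; rewrite mem_filter /= -(perm_mem wX).
  move: uw; rewrite -{1 4}(cat_take_drop a w) cat_uniq mem_cat => /and3P[_ /hasPn tw _].
  case: (boolP (x \in drop a w)) => [/tw/= ->|_]; first by rewrite orbT.
  by rewrite orbF andNb.
rewrite big_seq (partition_big mk (fun m => count id m == a)) => [|w]; last first.
  rewrite mem_permutations => wX /=; rewrite count_map.
  rewrite -(eq_count (a1 := mem (take a w))) // -size_filter.
  by rewrite -(perm_size (filt w wX)) size_takel // (perm_size wX).
apply: eq_bigr => m /eqP cm.
have sm : size m = size X by rewrite size_tuple.
have smX : size (mask m X) = a by rewrite size_mask.
rewrite -(big_allpairs (r1 := permutations (mask m X))
   (r2 := permutations (mask (map negb m) X)) (F := fun uv => G uv.1 uv.2)).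
rewrite -big_seq_cond -big_filter.
rewrite (_ : \sum_(w <- _) _ = \sum_(uv <-
   [seq (take a w, drop a w) | w <- permutations X & mk w == m]) G uv.1 uv.2); last first.
  by rewrite big_map.
apply: perm_big; apply: uniq_perm.
- rewrite map_inj_uniq ?filter_uniq ?permutations_uniq // => w w' [t d].
  by rewrite -(cat_take_drop a w) t d cat_take_drop.
- apply: allpairs_uniq; rewrite ?permutations_uniq //.
  by move=> [u v] [u' v'].
move=> [u v]; apply/mapP/allpairsP => /=.
  case=> w; rewrite mem_filter mem_permutations => /andP[/eqP em wX] [-> ->].
  exists (take a w, drop a w); split=> //=.
    by rewrite mem_permutations -em /= -filter_mask filt.
  by rewrite mem_permutations -em /= -map_comp -filter_mask filtC.
case=> -[u' v'] /= []; rewrite !mem_permutations => pu pv [-> ->].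
have tu : take a (u' ++ v') = u'
  by rewrite take_cat -smX (perm_size pu) ltnn subnn take0 cats0.
have du : drop a (u' ++ v') = v' by rewrite drop_cat -smX (perm_size pu) ltnn subnn drop0.
exists (u' ++ v'); last by rewrite tu du.
have emk : map (fun x => x \in u') X = m.
  rewrite -[in RHS](mem_map_mask uX sm); apply/eq_map => x /=.
  exact: (perm_mem pu).
rewrite mem_filter mem_permutations; apply/andP; split.
  by apply/eqP/val_inj; rewrite /= tu.
rewrite (perm_trans (perm_cat pu pv)) //.
rewrite -emk -map_comp -!filter_mask.
by rewrite perm_filterC.
Qed.

(** The q-binomial coefficient [size X choose a], as the generating function of
    the a-subsets of X by the number of inversions that they force; the closed
    form is shuffle_sumE. *)
Definition shuffle_sum X a : F :=
  \sum_(m : (size X).-tuple bool | count id m == a)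
     q ^+ cross (mask m X) (mask (map negb m) X).

(** For a given set of first letters, the inversions between the two halves do
    not depend on the orders of the letters in them, so that the sums over
    these orders separate. *)
Lemma wsum_split phi psi n a : order_inv phi -> order_inv psi -> (a <= n)%N ->
  wsum (fun w => phi (take a w) * psi (drop a w)) (iota 0 n) =
  shuffle_sum (iota 0 n) a * (wsum phi (iota 0 a) * wsum psi (iota 0 (n - a))).
Proof.
move=> iphi ipsi an; set X := iota 0 n.
have sX : sorted ltn X := iota_ltn_sorted 0 n.
have szX : size X = n by rewrite size_iota.
rewrite {1}/wsum /shuffle_sum mulr_suml.
under eq_bigr => w _ do rewrite -{1}(cat_take_drop a w) inv_catE.
rewrite (big_permutations_split (fun u v => q ^+ (cross u v + (inv u + inv v)) *
   (phi u * psi v))) ?iota_uniq ?szX //.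
apply: eq_bigr => m /eqP cm.
have sm : size m = size X by rewrite size_tuple.
have s1 : size (mask m X) = a by rewrite size_mask.
have s2 : size (mask (map negb m) X) = (n - a)%N.
  rewrite size_mask ?size_map // count_map //.
  apply: (@addnI a); rewrite subnKC //.
  by have := count_predC id m; rewrite sm szX cm.
rewrite -{1}s1 -s2.
rewrite -!wsum_iota ?sorted_mask //; try exact: ltn_trans.
rewrite /wsum mulr_suml mulr_sumr big_seq [RHS]big_seq; apply: eq_bigr => u.
rewrite mem_permutations => pu.
rewrite !mulr_sumr big_seq [RHS]big_seq; apply: eq_bigr => v.
rewrite mem_permutations => pv.
by rewrite (cross_perm pu pv) !exprD -!mulrA; congr (_ * (_ * _)); rewrite mulrCA.
Qed.

End WordSums.

(** * Hook factorizations *)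

Section HookFactorization.
Implicit Types (w p v : seq nat) (g : nat -> nat).

Lemma mono_path g : mono_nat g -> forall x w, path ltn (g x) (map g w) = path ltn x w.
Proof. by move=> mg x w; rewrite path_map; apply: eq_path => y z; exact: mg. Qed.

Lemma sorted_order_inv : order_inv (sorted ltn).
Proof. by move=> g mg [] //= x w; rewrite mono_path. Qed.

Lemma is_hook_order_inv : order_inv is_hook.
Proof. by move=> g mg [|x [|y w]] //=; rewrite mono_path // mg. Qed.

Lemma hook_factorization_map g : mono_nat g -> forall w,
  hook_factorization (map g w) =
  (map g (hook_factorization w).1, map (map g) (hook_factorization w).2).
Proof.
move=> mg; elim=> //= x w ->; case: (hook_factorization w) => -[|y p] taus //=.
by rewrite mg; case: ifP.
Qed.

Lemma lec_order_inv : order_inv lec.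
Proof.
move=> g mg w; rewrite /lec hook_factorization_map //= big_map.
by apply: eq_bigr => tau _; rewrite inv_order_inv.
Qed.

Lemma lec_factorization w p taus : is_hook_factorization w p taus ->
  lec w = (\sum_(tau <- taus) inv tau)%N.
Proof. by move=> /hook_factorization_uniq; rewrite /lec => ->. Qed.

Definition hooks_only w := (hook_factorization w).1 == [::].

Lemma hooks_only_order_inv : order_inv hooks_only.
Proof.
move=> g mg w; rewrite /hooks_only hook_factorization_map //=.
by case: (hook_factorization w).1.
Qed.

Lemma hooks_onlyP w : uniq w -> hooks_only w ->
  exists taus, is_hook_factorization w [::] taus.
Proof.
move=> uw /eqP hw; exists (hook_factorization w).2; rewrite -hw.
exact: hook_factorizationP.
Qed.

Lemma hooks_only_flatten taus : all is_hook taus ->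
  is_hook_factorization (flatten taus) [::] taus.
Proof. by move=> ht; rewrite /is_hook_factorization eqxx ht. Qed.

End HookFactorization.

(** * q-exponential generating functions of weights on words *)

Section Functionals.
Variables (F : fieldType) (q t : F).
Implicit Types (f phi psi G : seq nat -> F) (X v w : seq nat).
Local Notation u := (t / q).

Lemma wsum_nil f : wsum q f [::] = f [::].
Proof. by rewrite /wsum big_seq1 inv_nil mul1r. Qed.

(** The increasing arrangement is the only one that contributes. *)
Lemma wsum_sorted G X : sorted ltn X ->
  wsum q (fun w => (sorted ltn w)%:R * G w) X = G X.
Proof.
move=> sX; rewrite /wsum.
rewrite (bigD1_seq X) ?permutations_uniq ?mem_permutations //=.
rewrite sX inv_sorted // !mul1r big_seq_cond big1 ?addr0 // => w.
rewrite mem_permutations => /andP[wX neq]; case: (boolP (sorted ltn w)) => [sw|_].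
  case/eqP: neq; apply: (irr_sorted_eq ltn_trans ltnn) => //; exact: perm_mem.
by rewrite mul0r mulr0.
Qed.

Lemma sorted_rem x n : sorted ltn (rem x (iota 0 n)).
Proof.
apply: subseq_sorted (rem_subseq _ _) (iota_ltn_sorted 0 n); exact: ltn_trans.
Qed.

Lemma count_ltn_iota x n : (x <= n)%N -> count (fun y => y < x)%N (iota 0 n) = x.
Proof.
move=> xn; rewrite -(subnKC xn) iotaD count_cat add0n.
rewrite (@eq_in_count _ _ predT) => [|y]; last by rewrite mem_iota.
rewrite count_predT size_iota (@eq_in_count _ _ pred0) ?count_pred0 ?addn0 //.
by move=> y; rewrite mem_iota => /andP[xy _]; rewrite ltnNge xy.
Qed.

Lemma count_ltn_rem x n : (x < n)%N ->
  count (fun y => y < x)%N (rem x (iota 0 n)) = x.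
Proof.
move=> xn; have xX : x \in iota 0 n by rewrite mem_iota.
rewrite -[RHS](@count_ltn_iota x n) 1?ltnW //.
by rewrite (permP (perm_to_rem xX)) /= ltnn.
Qed.

Lemma wsum_cons_iota f n : (0 < n)%N -> wsum q f (iota 0 n) =
  \sum_(x < n) q ^+ x * wsum q (fun w => f (nat_of_ord x :: w))
    (rem (nat_of_ord x) (iota 0 n)).
Proof.
move=> n0; rewrite wsum_cons ?iota_uniq ?size_iota //.
rewrite -[in X in \sum_(x <- X) _](subn0 n) -/(index_iota 0 n) big_mkord.
by apply: eq_bigr => x _; rewrite count_ltn_iota // ltnW.
Qed.

Lemma qpochS n : qpoch q n.+1 = qpoch q n * (1 - q ^+ n.+1).
Proof. by rewrite /qpoch big_nat_recr. Qed.

(** The first letter x contributes q^x, whatever follows it; this is the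
    recursion of the q-factorial. *)
Lemma wsum1 n : (1 - q) ^+ n * wsum q (fun=> 1) (iota 0 n) = qpoch q n.
Proof.
elim: n => [|n IH]; first by rewrite wsum_nil mulr1 /qpoch big_geq.
rewrite wsum_cons_iota // qpochS -IH -[1 - q ^+ n.+1]opprB subrX1.
have eS x : (x < n.+1)%N ->
    wsum q (fun=> 1) (rem x (iota 0 n.+1)) = wsum q (fun=> 1) (iota 0 n).
  move=> xn; rewrite wsum_iota ?sorted_rem //.
  by rewrite size_rem ?mem_iota // size_iota.
under eq_bigr => x _ do rewrite eS //.
rewrite -mulr_suml exprSr -mulNr opprB -!mulrA; congr (_ * _).
by rewrite mulrA mulrC.
Qed.

Definition qegf f n := wsum q f (iota 0 n) / qpoch q n.

(** The concatenation product of functions on words. *)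
Definition wconv phi psi w :=
  \sum_(a < (size w).+1) phi (take a w) * psi (drop a w).

Lemma wconv_order_inv phi psi :
  order_inv phi -> order_inv psi -> order_inv (wconv phi psi).
Proof.
move=> iphi ipsi g mg w; rewrite /wconv size_map; apply: eq_bigr => a _.
by rewrite -map_take -map_drop iphi // ipsi.
Qed.

Section Nonzero.
Hypothesis qpoch0 : forall n, qpoch q n != 0.

(** The case phi = psi = 1 of wsum_split, in which all the sums over words are
    q-factorials, determines the shuffle sum. *)
Lemma shuffle_sumE n a : (a <= n)%N ->
  shuffle_sum q (iota 0 n) a = qpoch q n / (qpoch q a * qpoch q (n - a)).
Proof.
move=> an; apply/(canRL (mulfK _)); first by rewrite mulf_neq0.
have i1 : order_inv (fun=> 1 : F) by [].
have := wsum_split q i1 i1 an.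
rewrite (@eq_wsum _ q _ (fun=> 1)) ?iota_uniq // => [|w _ _]; last by rewrite mulr1.
move=> E; have eX : (1 - q) ^+ n = (1 - q) ^+ a * (1 - q) ^+ (n - a).
  by rewrite -exprD subnKC.
by rewrite -!wsum1 E eX [RHS]mulrCA; congr (_ * _); exact: mulrACA.
Qed.

Lemma wsum_splitE phi psi n a : order_inv phi -> order_inv psi -> (a <= n)%N ->
  wsum q (fun w => phi (take a w) * psi (drop a w)) (iota 0 n) =
  qpoch q n * (qegf phi a * qegf psi (n - a)).
Proof.
move=> iphi ipsi an; rewrite wsum_split // shuffle_sumE // /qegf.
by rewrite -[LHS]mulrA [_ / _ * (_ / _)]mulrACA -invfM [X in _ * X]mulrC.
Qed.

(** The reason for dividing by (q;q)_n: the q-binomial coefficients of the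
    splitting are absorbed, and what remains is a Cauchy product. *)
Lemma qegf_wconv phi psi : order_inv phi -> order_inv psi ->
  qegf (wconv phi psi) =1 fps_mul (qegf phi) (qegf psi).
Proof.
move=> iphi ipsi n; rewrite {1}/qegf /fps_mul.
rewrite (_ : wsum q _ _ = \sum_(a < n.+1)
  wsum q (fun w => phi (take a w) * psi (drop a w)) (iota 0 n)); last first.
  rewrite /wsum exchange_big /= big_seq [RHS]big_seq; apply: eq_bigr => w.
  rewrite mem_permutations => /perm_size sw.
  by rewrite /wconv sw size_iota mulr_sumr.
under eq_bigr => a _ do rewrite wsum_splitE -1?ltnS //.
by rewrite -mulr_sumr mulrC mulKf.
Qed.

End Nonzero.

(** * Weights that encode hook factorizations *)

Definition empty_wt w : F := (w == [::])%:R.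
Definition incr_wt w : F := (sorted ltn w)%:R.
Definition hook_wt w : F := (is_hook w)%:R * u ^+ inv w.
Definition hooks_wt w : F := (hooks_only w)%:R * u ^+ lec w.
Definition lec_wt w : F := u ^+ lec w.
(** On x p this is q u^inv(x z p) for a letter z below all the others: putting z
    after x makes x p into a hook with one more inversion, and q u = t. *)
Definition min_hook_wt w : F :=
  if w is x :: p then (sorted ltn p)%:R * (t * u ^+ inv w) else 0.
(** The weight of the part of a word that starts with the letter before 1,
    when 1 is erased. *)
Definition suffix_wt w : F := empty_wt w + wconv min_hook_wt hooks_wt w.

Lemma empty_wt_inv : order_inv empty_wt.
Proof. by move=> g _ []. Qed.
Lemma incr_wt_inv : order_inv incr_wt.
Proof. by move=> g mg w; rewrite /incr_wt sorted_order_inv. Qed.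
Lemma hook_wt_inv : order_inv hook_wt.
Proof. by move=> g mg w; rewrite /hook_wt is_hook_order_inv // inv_order_inv. Qed.
Lemma hooks_wt_inv : order_inv hooks_wt.
Proof. by move=> g mg w; rewrite /hooks_wt hooks_only_order_inv // lec_order_inv. Qed.
Lemma lec_wt_inv : order_inv lec_wt.
Proof. by move=> g mg w; rewrite /lec_wt lec_order_inv. Qed.
Lemma min_hook_wt_inv : order_inv min_hook_wt.
Proof.
move=> g mg [|x p] //=; rewrite -/(map g (x :: p)) inv_order_inv //.
by rewrite sorted_order_inv.
Qed.
Lemma suffix_wt_inv : order_inv suffix_wt.
Proof.
move=> g mg w; rewrite /suffix_wt empty_wt_inv // wconv_order_inv //.
  exact: min_hook_wt_inv. exact: hooks_wt_inv.
Qed.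

Lemma wconv_only phi psi w a : (a <= size w)%N ->
  (forall i, (i <= size w)%N -> phi (take i w) * psi (drop i w) != 0 -> i = a) ->
  wconv phi psi w = phi (take a w) * psi (drop a w).
Proof.
rewrite -ltnS => aw only; rewrite /wconv (bigD1 (Ordinal aw)) //= big1 ?addr0 // => i ia.
by apply/eqP; apply: contraNT ia => /only e; apply/eqP/val_inj/e; rewrite -ltnS.
Qed.

(** A cut of w into an increasing word and a product of hooks yields a hook
    factorization of w, so there is only one such cut, after the increasing
    prefix. *)
Lemma wconv_sorted_prefix G w : uniq w ->
  wconv (fun p => (sorted ltn p)%:R * G p) hooks_wt w =
  G (hook_factorization w).1 * u ^+ lec w.
Proof.
move=> uw; have fw := hook_factorizationP uw.
set p := _.1 in fw *; set taus := _.2 in fw *.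
have [/eqP ew sp ht] := and3P fw.
have ft := hooks_only_flatten ht.
have tk : take (size p) w = p by rewrite ew take_size_cat.
have dr : drop (size p) w = flatten taus by rewrite ew drop_size_cat.
rewrite (@wconv_only _ _ _ (size p)).
- rewrite tk dr sp mul1r /hooks_wt /hooks_only (hook_factorization_uniq ft) mul1r.
  by rewrite (lec_factorization fw) (lec_factorization ft).
- by rewrite ew size_cat leq_addr.
move=> a aw; case: (boolP (sorted _ _)) => sa; last by rewrite !mul0r eqxx.
rewrite /hooks_wt; case: (boolP (hooks_only _)) => [/hooks_onlyP|]; last first.
  by rewrite mul0r mulr0 eqxx.
case=> [|taus' /and3P[/eqP da _ ht'] _]; first exact: drop_uniq.
have fa : is_hook_factorization w (take a w) taus'.
  by rewrite /is_hook_factorization -{1}(cat_take_drop a w) da /= eqxx sa.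
have := hook_factorization_uniq fa; rewrite (hook_factorization_uniq fw).
by case=> -> _; rewrite size_takel.
Qed.

Lemma lec_wtE w : uniq w -> lec_wt w = wconv incr_wt hooks_wt w.
Proof.
move=> uw; have := wconv_sorted_prefix (fun=> 1) uw; rewrite mul1r /lec_wt => <-.
by apply: eq_bigr => a _; rewrite mulr1.
Qed.

(** A nonempty product of hooks has exactly one cut into a hook and a product
    of hooks: any such cut yields a hook factorization of w. *)
Lemma hooks_wtE w : uniq w -> hooks_wt w = empty_wt w + wconv hook_wt hooks_wt w.
Proof.
move=> uw; have fw := hook_factorizationP uw.
have fact a taus' : is_hook (take a w) -> is_hook_factorization (drop a w) [::] taus' ->
    hook_factorization w = ([::], take a w :: taus').
  move=> hk /and3P[/eqP da _ ht']; apply: hook_factorization_uniq.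
  by rewrite /is_hook_factorization -{1}(cat_take_drop a w) da /= eqxx hk.
have nz a : hook_wt (take a w) * hooks_wt (drop a w) != 0 ->
    exists taus', hook_factorization w = ([::], take a w :: taus').
  rewrite /hook_wt; case: (boolP (is_hook _)) => ha; last by rewrite !mul0r eqxx.
  rewrite /hooks_wt; case: (boolP (hooks_only _)) => [/hooks_onlyP|]; last first.
    by rewrite mul0r mulr0 eqxx.
  case=> [|taus' fa _]; first exact: drop_uniq.
  by exists taus'; apply: fact.
rewrite {1}/hooks_wt /hooks_only.
case ew : (hook_factorization w) fw => [p taus] fw /=.
case: p => [|x p] in ew fw *; last first.
  rewrite mul0r /wconv big1 => [|a _]; last first.
    by apply/eqP; apply: contraTT isT => /nz[taus']; rewrite ew.
  rewrite addr0 /empty_wt; case: eqP ew => // ->; by [].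
case: taus => [|tau taus] in ew fw *.
  have w0 : w = [::] by case/and3P: fw => /eqP.
  by rewrite w0 /wconv big_ord1 /= /hook_wt /= !mul0r addr0 /empty_wt /lec big_nil mul1r.
have [/eqP wE _ /andP[htau ht]] := and3P fw.
have ft := hooks_only_flatten ht.
have tk : take (size tau) w = tau by rewrite wE /= take_size_cat.
have dr : drop (size tau) w = flatten taus by rewrite wE /= drop_size_cat.
rewrite (@wconv_only _ _ _ (size tau)).
- rewrite tk dr /hook_wt /hooks_wt /hooks_only htau (hook_factorization_uniq ft) !mul1r.
  rewrite -exprD (lec_factorization fw) (lec_factorization ft) big_cons.
  by rewrite /empty_wt wE; case: (tau) htau => //= x s _; rewrite add0r.
- by rewrite wE /= size_cat leq_addr.
move=> a aw /nz[taus']; rewrite ew => -[-> _].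
by rewrite size_takel.
Qed.

Lemma suffix_wt_cons x v : uniq v -> suffix_wt (x :: v) =
  t * u ^+ inv (x :: (hook_factorization v).1) * u ^+ lec v.
Proof.
move=> uv; rewrite /suffix_wt /empty_wt /= add0r.
have := wconv_sorted_prefix (fun p => t * u ^+ inv (x :: p)) uv => <-.
by rewrite /wconv [LHS]big_ord_recl /= mul0r add0r.
Qed.

Lemma qegf_empty n : qegf empty_wt n = (n == 0)%:R.
Proof.
rewrite /qegf; case: n => [|n].
  by rewrite wsum_nil /empty_wt /qpoch big_geq // divr1.
rewrite /wsum big_seq big1 ?mul0r // => w; rewrite mem_permutations => /perm_size.
by rewrite size_iota /empty_wt; case: w => // x w _; rewrite mulr0.
Qed.

Lemma qegf_incr n : qegf incr_wt n = qexp q 1 n.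
Proof.
rewrite /qegf /qexp expr1n; congr (_ / _).
rewrite -(wsum_sorted (fun=> 1) (iota_ltn_sorted 0 n)).
by apply: eq_bigr => w _; rewrite mulr1.
Qed.

Hypothesis q0 : q != 0.

Lemma expr_q_ratio x : q ^+ x * u ^+ x = t ^+ x.
Proof. by rewrite -exprMn mulrC divfK. Qed.

(** Such a weight vanishes unless the word increases after its first letter,
    so that the first letter determines the word. *)
Lemma wsum_first_letter (G : nat -> seq nat -> F) f n : (0 < n)%N ->
  (forall x w, f (x :: w) = (sorted ltn w)%:R * G x w) ->
  wsum q f (iota 0 n) = \sum_(x < n) q ^+ x * G x (rem (nat_of_ord x) (iota 0 n)).
Proof.
move=> n0 fG; rewrite wsum_cons_iota //; apply: eq_bigr => x _; congr (_ * _).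
rewrite -(wsum_sorted (G x)) ?sorted_rem //.
by apply: eq_bigr => w _; rewrite fG.
Qed.

Lemma inv_cons_rem x n : (x < n)%N -> inv (x :: rem x (iota 0 n)) = x.
Proof.
by move=> xn; rewrite inv_cons inv_sorted ?sorted_rem // addn0 count_ltn_rem.
Qed.

Lemma qegf_min_hook n : qegf min_hook_wt n = (\sum_(x < n) t ^+ x.+1) / qpoch q n.
Proof.
rewrite /qegf; congr (_ / _); case: n => [|n]; first by rewrite wsum_nil big_ord0.
rewrite (@wsum_first_letter (fun x w => t * u ^+ inv (x :: w))) //.
by apply: eq_bigr => x _; rewrite inv_cons_rem // mulrCA expr_q_ratio exprS.
Qed.

(** The inversion number of a hook on {0, ..., n-1} is its first letter, which
    is any letter but the least. *)
Lemma qegf_hook n : qegf hook_wt n = (\sum_(x < n | (0 < x)%N) t ^+ x) / qpoch q n.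
Proof.
rewrite /qegf; congr (_ / _); case: n => [|n].
  by rewrite wsum_nil big_ord0 /hook_wt mul0r.
rewrite (@wsum_first_letter (fun x w => (head x w < x)%N%:R * u ^+ inv (x :: w))) //.
  rewrite [RHS]big_mkcond; apply: eq_bigr => x _.
  rewrite inv_cons_rem // mulrCA expr_q_ratio.
  suff -> : (head (nat_of_ord x) (rem (nat_of_ord x) (iota 0 n.+1)) < x)%N = (0 < x)%N.
    by case: (0 < x)%N; rewrite ?mul1r ?mul0r.
  case: x => -[|x] xn //=; case: n xn => //.
move=> x [|y w]; rewrite /hook_wt /=; first by rewrite ltnn !mul0r mulr0.
by rewrite mulrA -natrM mulnb andbC.
Qed.

End Functionals.

(** * Formal power series *)

Section Series.
Variable F : fieldType.
Implicit Types a b c : nat -> F.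

(** Transfers the ring laws of polynomials to power series, by truncation. *)
Lemma fps_mulE a b n m : (n < m)%N ->
  fps_mul a b n = ((\poly_(i < m) a i) * (\poly_(i < m) b i))`_n.
Proof.
move=> nm; rewrite coefM; apply: eq_bigr => i _; rewrite !coef_poly.
rewrite (leq_ltn_trans (leq_subr _ _) nm) (leq_trans (ltn_ord i)) //.
Qed.

Lemma eq_fps_mul a a' b b' : a =1 a' -> b =1 b' -> fps_mul a b =1 fps_mul a' b'.
Proof. by move=> aa bb n; apply: eq_bigr => i _; rewrite aa bb. Qed.

Lemma fps_mulC a b : fps_mul a b =1 fps_mul b a.
Proof. by move=> n; rewrite !(@fps_mulE _ _ _ n.+1) // mulrC. Qed.

Lemma fps_mulA a b c : fps_mul (fps_mul a b) c =1 fps_mul a (fps_mul b c).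
Proof.
move=> n; set pa := \poly_(i < n.+1) a i; set pb := \poly_(i < n.+1) b i.
set pc := \poly_(i < n.+1) c i.
transitivity ((pa * pb * pc)`_n).
  rewrite coefM; apply: eq_bigr => i _; rewrite -fps_mulE // coef_poly.
  by rewrite ltnS leq_subr.
rewrite -mulrA coefM; apply: eq_bigr => i _.
by rewrite -fps_mulE ?ltnS ?leq_subr // coef_poly ltn_ord.
Qed.

Lemma fps_mulDl a b c n :
  fps_mul (fun i => a i + b i) c n = fps_mul a c n + fps_mul b c n.
Proof. by rewrite -big_split; apply: eq_bigr => i _; rewrite mulrDl. Qed.

Lemma fps_mulZl s a b n : fps_mul (fun i => s * a i) b n = s * fps_mul a b n.
Proof. by rewrite mulr_sumr; apply: eq_bigr => i _; rewrite mulrA. Qed.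

Lemma fps_mul_monomial s k b n : (k <= n)%N ->
  fps_mul (fun i => if i == k then s else 0) b n = s * b (n - k)%N.
Proof.
rewrite -ltnS => kn; rewrite /fps_mul (bigD1 (Ordinal kn)) //= eqxx.
rewrite big1 ?addr0 // => i ik.
by rewrite -val_eqE /= in ik; rewrite (negbTE ik) mul0r.
Qed.

Lemma fps_div_unique a b c : b 0%N != 0 -> fps_mul c b =1 a -> fps_div a b =1 c.
Proof.
move=> b0 cb n; elim/ltn_ind: n => n IH; rewrite fps_divE -cb.
apply: (canLR (mulfK b0)).
rewrite /fps_mul big_ord_recr /= subnn addrAC -sumrB big1 ?add0r // => i _.
by rewrite IH // subrr.
Qed.

End Series.

(** * Eulerian polynomials as weighted sums over words *)

Section EulerianSeries.
Variables (F : fieldType) (q t : F).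
Hypothesis q0 : q != 0.
Hypothesis qpoch0 : forall n, qpoch q n != 0.

Let den := eulerian_den q t.
Let one (n : nat) : F := if n == 0%N then 1 else 0.

Lemma eulerian_den0 : den 0%N = 1 - t.
Proof. by rewrite /den /eulerian_den /qexp /qpoch big_geq // !expr0 divr1 mulr1. Qed.

Lemma fps_mul1 (a : nat -> F) : fps_mul one a =1 a.
Proof. by move=> n; rewrite fps_mul_monomial // mul1r subn0. Qed.

Lemma geometric_sum n : (1 - t) * (\sum_(x < n) t ^+ x.+1) = t - t ^+ n.+1.
Proof.
under eq_bigr => i _ do rewrite exprS.
by rewrite -mulr_sumr mulrCA -opprB mulNr -subrX1 opprB mulrBr mulr1 exprS.
Qed.

(** Products of hooks are generated by 1 / (1 - G(hook)), and the denominator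
    is 1 - t times 1 - G(hook). *)
Lemma eulerian_denE n : den n = (1 - t) * (one n - qegf q (hook_wt q t) n).
Proof.
rewrite qegf_hook //; case: n => [|n].
  by rewrite eulerian_den0 big_ord0 mul0r subr0 mulr1.
rewrite /one /= sub0r big_mkcond big_ord_recl /= add0r mulrN mulrA.
rewrite geometric_sum -mulNr opprB mulrBl.
by rewrite /den /eulerian_den /qexp expr1n mul1r.
Qed.

Lemma qegf_hooks_den :
  fps_mul (qegf q (hooks_wt q t)) den =1 (fun n => (1 - t) * one n).
Proof.
move=> n; rewrite fps_mulC (eq_fps_mul eulerian_denE (frefl _)) fps_mulZl.
congr (_ * _).
rewrite (_ : fps_mul _ _ n = qegf q (hooks_wt q t) n -
   fps_mul (qegf q (hook_wt q t)) (qegf q (hooks_wt q t)) n); last first.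
  rewrite fps_mulDl fps_mul1; congr (_ + _).
  by rewrite /fps_mul -sumrN; apply: eq_bigr => i _; rewrite mulNr.
rewrite -qegf_wconv //; [|exact: hook_wt_inv|exact: hooks_wt_inv].
apply/eqP; rewrite subr_eq; apply/eqP.
transitivity (qegf q (empty_wt F) n + qegf q (wconv (hook_wt q t) (hooks_wt q t)) n).
  rewrite /qegf -mulrDl; congr (_ / _).
  rewrite /wsum -big_split big_seq [RHS]big_seq; apply: eq_bigr => w /=.
  rewrite mem_permutations => /perm_uniq uw.
  by rewrite hooks_wtE ?uw ?iota_uniq // mulrDr.
by rewrite qegf_empty /one; case: (n == 0%N).
Qed.

Hypothesis t1 : 1 - t != 0.

Lemma eulerian_den0_neq0 : den 0%N != 0. Proof. by rewrite eulerian_den0. Qed.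

Lemma q_eulerian_lec n : q_eulerian q t n / qpoch q n = qegf q (lec_wt q t) n.
Proof.
rewrite /q_eulerian /qr_eulerian mulrC mulKf //.
apply: fps_div_unique => [|m]; first exact: eulerian_den0_neq0.
rewrite (@eq_fps_mul _ _ (fps_mul (qegf q (incr_wt F)) (qegf q (hooks_wt q t))) _ den) //.
  rewrite fps_mulA (eq_fps_mul (@qegf_incr _ q) qegf_hooks_den).
  by rewrite fps_mulC fps_mulZl fps_mul1.
move=> i; rewrite -qegf_wconv //; [|exact: incr_wt_inv|exact: hooks_wt_inv].
congr (_ / _); apply: eq_wsum => [|w uw _]; first exact: iota_uniq.
exact: lec_wtE.
Qed.

Lemma suffix_series n :
  fps_div (fun m => qexp q t m - t * qexp q t m) den n = qegf q (suffix_wt q t) n.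
Proof.
apply: fps_div_unique => [|m]; first exact: eulerian_den0_neq0.
rewrite (@eq_fps_mul _ _ (fun i => one i +
  fps_mul (qegf q (min_hook_wt q t)) (qegf q (hooks_wt q t)) i) _ den) //; last first.
  move=> i; rewrite -qegf_wconv //; [|exact: min_hook_wt_inv|exact: hooks_wt_inv].
  transitivity (qegf q (empty_wt F) i +
    qegf q (wconv (min_hook_wt q t) (hooks_wt q t)) i).
    rewrite /qegf -mulrDl; congr (_ / _).
    by rewrite /wsum -big_split; apply: eq_bigr => w _; rewrite /= -mulrDr.
  by rewrite qegf_empty /one; case: (i == 0%N).
rewrite fps_mulDl fps_mul1 fps_mulA (eq_fps_mul (frefl _) qegf_hooks_den).
rewrite fps_mulC fps_mulZl fps_mul1 qegf_min_hook //.
rewrite mulrA geometric_sum /den /eulerian_den /qexp expr1n mul1r mulrA -!mulrBl -mulrDl.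
by congr (_ / _); rewrite addrA subrK exprS.
Qed.

(** The factor supported in degree j-1 and the quotient of series are the
    generating functions of the two halves of words cut after j-1 letters. *)
Lemma restr_eulerianE n j : (1 <= j)%N -> (j <= n)%N ->
  restr_eulerian q t n j = wsum q (fun w => q ^+ j.-1 *
     (lec_wt q t (take j.-1 w) * suffix_wt q t (drop j.-1 w))) (iota 0 n.-1).
Proof.
case: j n => [|j] [|n] //= _; rewrite ltnS => jn.
rewrite /wsum; under eq_bigr => w _ do rewrite mulrCA.
rewrite -mulr_sumr -/(wsum _ _ _).
rewrite wsum_splitE //; [|exact: lec_wt_inv|exact: suffix_wt_inv].
rewrite /restr_eulerian /restr_eulerian_series /= fps_mul_monomial // suffix_series.
rewrite -q_eulerian_lec [RHS]mulrCA; congr (_ * _); rewrite [RHS]mulrA.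
by congr (_ * _); rewrite [q_eulerian _ _ _ * _]mulrC -mulrA.
Qed.

End EulerianSeries.

(** * Erasing the letter 1 *)

Section RemoveOne.
Implicit Types (v w alpha beta : seq nat).
Local Notation gt1 := (all (fun y => 1 < y)%N).

Lemma count_lt1 w : gt1 w -> count (fun y => y < 1)%N w = 0%N.
Proof.
move=> /allP w1; apply/eqP; rewrite -leqn0 leqNgt -has_count.
by apply/hasPn => y /w1; rewrite -leqNgt; apply: ltnW.
Qed.

Lemma cross_cons1 v w : gt1 v -> cross v (1%N :: w) = (size v + cross v w)%N.
Proof.
elim: v => [|x v IH] /=; first by rewrite /cross !big_nil.
by case/andP=> x1 /IH; rewrite /cross !big_cons /= x1 => ->; rewrite addnACA.
Qed.

Lemma inv_insert1 v w : gt1 v -> gt1 w ->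
  inv (v ++ 1%N :: w) = (size v + inv (v ++ w))%N.
Proof.
by move=> v1 w1; rewrite !inv_catE cross_cons1 // inv_cons count_lt1 // -addnA.
Qed.

(** The letter 1 extends the increasing prefix of beta on the left, and the
    larger letter x in front of it then closes this prefix into a hook. *)
Lemma lec_insert1 alpha x beta : uniq alpha -> uniq beta -> (1 < x)%N -> gt1 beta ->
  lec (alpha ++ [:: x, 1%N & beta]) =
  (lec alpha + (inv (x :: (hook_factorization beta).1)).+1 + lec beta)%N.
Proof.
move=> ua ub x1 b1; have fb := hook_factorizationP ub; have fa := hook_factorizationP ua.
move: fb fa; set p := (hook_factorization beta).1; set taus := _.2.
set p' := _.1; set sigmas := _.2 => fb fa.
rewrite (lec_factorization fa) (lec_factorization fb).
case/and3P: fb => /eqP eb sp ht; case/and3P: fa => /eqP ea sp' hs.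
have p1 : gt1 p by move: b1; rewrite eb all_cat => /andP[].
have inv1 : inv [:: x, 1%N & p] = (inv (x :: p)).+1.
  by rewrite !inv_cons /= x1 (count_lt1 p1) add0n addSn.
rewrite (@lec_factorization _ p' (sigmas ++ [:: x, 1%N & p] :: taus)).
  by rewrite big_cat big_cons /= inv1 addnA.
rewrite /is_hook_factorization flatten_cat /= catA {1}ea {1}eb eqxx sp' all_cat hs /=.
rewrite x1 ht andbT; case: (p) sp p1 => //= y r sr /andP[y1 _].
by rewrite y1.
Qed.

Lemma perm_barS_insert1 n j : (j < n)%N ->
  perm_eq [seq w <- permutations (iota 1 n) | nth 0%N w j == 1%N]
          [seq take j v ++ 1%N :: drop j v | v <- permutations (iota 2 n.-1)].
Proof.
case: n => // n; rewrite ltnS /= => jn.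
have ins_perm v : perm_eq (take j v ++ 1%N :: drop j v) (1%N :: v).
  by rewrite -cat1s perm_catCA /= perm_cons cat_take_drop.
have take_ins v : size v = n -> take j (take j v ++ 1%N :: drop j v) = take j v.
  by move=> sv; rewrite take_size_cat // size_takel ?sv.
have drop_ins v : size v = n -> drop j (take j v ++ 1%N :: drop j v) = 1%N :: drop j v.
  by move=> sv; rewrite drop_size_cat // size_takel ?sv.
have szP v : v \in permutations (iota 2 n) -> size v = n.
  by rewrite mem_permutations => /perm_size ->; rewrite size_iota.
apply: uniq_perm.
- by rewrite filter_uniq ?permutations_uniq.
- rewrite map_inj_in_uniq ?permutations_uniq // => v v' /szP sv /szP sv' e.
  have et : take j v = take j v' by rewrite -(take_ins v) // e take_ins.
  have := congr1 (drop j) e; rewrite !drop_ins // => -[ed].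
  by rewrite -(cat_take_drop j v) et ed cat_take_drop.
move=> w; rewrite mem_filter mem_permutations.
apply/andP/mapP => [[/eqP w1 pw]|[v vP ->]].
  have sw : size w = n.+1 by rewrite (perm_size pw) /= size_iota.
  have wE : w = take j w ++ 1%N :: drop j.+1 w.
    by rewrite -w1 -drop_nth ?sw // cat_take_drop.
  have sj : size (take j w) = j by rewrite size_takel // sw ltnW.
  exists (take j w ++ drop j.+1 w).
    rewrite mem_permutations -(perm_cons 1%N) -[1%N :: iota 2 n]/(iota 1 n.+1).
    rewrite (perm_trans _ pw) // [X in perm_eq _ X]wE -cat1s perm_catCA.
    exact: perm_refl.
  by rewrite take_size_cat // drop_size_cat.
have sv := szP v vP; split.
  by rewrite nth_cat size_takel ?sv // ltnn subnn.
rewrite (perm_trans (ins_perm v)) // -[1%N :: iota 2 n]/(iota 1 n.+1) perm_cons.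
by rewrite -mem_permutations.
Qed.

End RemoveOne.

(** For j < n the factor q^j that 1 contributes to q^inv gives q^(j-1) and a q
    that turns the extra u of the hook x 1 into the t of suffix_wt; for j = n
    the n-1 letters before the empty position give q^(n-1) = q^(j-1). *)
Lemma barS_wsum (F : fieldType) (q t : F) n j : q != 0 -> (1 <= j)%N -> (j <= n)%N ->
  \sum_(b <- barS n j) q ^+ inv_bword b * (t / q) ^+ lec_bword b =
  wsum q (fun w => q ^+ j.-1 * (lec_wt q t (take j.-1 w) * suffix_wt q t (drop j.-1 w)))
    (iota 2 n.-1).
Proof.
move=> q0; case: j => // j _ jn; have n0 : (0 < n)%N by apply: leq_trans jn.
have wP w : w \in permutations (iota 2 n.-1) ->
    [/\ size w = n.-1, uniq w & all (fun y => 1 < y)%N w].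
  rewrite mem_permutations => pw; split; first by rewrite (perm_size pw) size_iota.
    by rewrite (perm_uniq pw) iota_uniq.
  by rewrite (perm_all _ pw); apply/allP => y; rewrite mem_iota => /andP[].
rewrite /barS; case: ltnP => [lt_jn|le_nj]; last first.
  have ej : j = n.-1 by apply/eqP; rewrite -eqSS prednK // eqn_leq jn le_nj.
  rewrite big_map /wsum big_seq [RHS]big_seq; apply: eq_bigr => w /wP[sw uw w1] /=.
  rewrite -cats1 inv_insert1 // cats0 sw -ej.
  rewrite take_oversize ?drop_oversize ?sw ?ej //.
  rewrite /suffix_wt /wconv big_ord1 /= mul0r addr0 /empty_wt eqxx mulr1.
  by rewrite exprD [X in X * _]mulrC -mulrA.
rewrite big_map (perm_big _ (perm_barS_insert1 lt_jn)) big_map.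
rewrite /wsum big_seq [RHS]big_seq; apply: eq_bigr => w /wP[sw uw w1] /=.
have jw : (j < size w)%N by rewrite sw -ltnS prednK.
have [ut ud] : uniq (take j w) /\ uniq (drop j.+1 w) by rewrite take_uniq ?drop_uniq.
have := w1; rewrite -{1}(cat_take_drop j.+1 w) all_cat => /andP[t1 d1].
have x1 : (1 < nth 0 w j)%N by apply: (allP w1); rewrite mem_nth.
rewrite inv_insert1 // cat_take_drop size_takel //.
rewrite (take_nth 0%N jw) cat_rcons lec_insert1 // (drop_nth 0%N jw) suffix_wt_cons //.
rewrite !exprD /lec_wt exprS [in LHS]exprS.
move: (q ^+ inv w) (q ^+ j) => a b.
by move: ((t / q) ^+ _) ((t / q) ^+ _) ((t / q) ^+ _) => c d e; field.
Qed.

(** The index type of the sums over barS has no decidable equality; all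
    replaces membership. *)
Lemma eq_big_all (R : nmodType) (I : Type) (P : pred I) (r : seq I) (f g : I -> R) :
  all P r -> (forall x, P x -> f x = g x) ->
  \sum_(x <- r) f x = \sum_(x <- r) g x.
Proof.
move=> Pr fg; elim: r Pr => [|x r IH] /=; first by rewrite !big_nil.
by case/andP=> /fg fgx /IH; rewrite !big_cons fgx => ->.
Qed.

Lemma restr_eulerian_barS (F : fieldType) (q t : F) n j :
  q != 0 -> (forall m, qpoch q m != 0) -> 1 - t != 0 -> (1 <= j)%N -> (j <= n)%N ->
  restr_eulerian q t n j =
  \sum_(b <- barS n j) q ^+ (inv_bword b - lec_bword b) * t ^+ lec_bword b.
Proof.
move=> q0 qp0 t1 hj hjn; rewrite restr_eulerianE //.
set f := fun w => _.
have inv_f : order_inv f.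
  move=> g mg w; rewrite /f -map_take -map_drop.
  by rewrite lec_wt_inv // suffix_wt_inv.
have := wsum_iota q inv_f (iota_ltn_sorted 2 n.-1); rewrite size_iota => <-.
rewrite -barS_wsum //.
apply: (eq_big_all (lec_leq_inv_barS n j)) => b /subnK {1}<-.
by rewrite exprD -mulrA expr_q_ratio.
Qed.

(** * Coefficients of the powers of t *)

Lemma q_in_Qqt_neq0 : q_in_Qqt != 0.
Proof. by rewrite tofrac_eq0 polyC_eq0 tofrac_eq0 polyX_eq0. Qed.

Theorem lemma12 (n j : nat) (hj : (1 <= j)%N) (hjn : (j <= n)%N) (k : nat) :
  restr_eulerian_num n j k =
  \sum_(b <- barS n j | lec_bword b == k)
     q_var ^+ (inv_bword b - lec_bword b).
Proof.
rewrite /restr_eulerian_num.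
rewrite (restr_eulerian_barS q_in_Qqt_neq0 qpoch_q_in_Qqt_neq0 one_sub_t_var_neq0 hj hjn).
have -> : \sum_(b <- barS n j)
    q_in_Qqt ^+ (inv_bword b - lec_bword b) * t_var ^+ lec_bword b
  = tofrac (\sum_(b <- barS n j)
      (q_var ^+ (inv_bword b - lec_bword b))%:P * 'X^(lec_bword b)).
  rewrite rmorph_sum; apply: eq_bigr => b _.
  by rewrite /q_in_Qqt /t_var -!rmorphXn -rmorphM.
rewrite tofracK coef_sum [RHS]big_mkcond.
apply: eq_bigr => b _; rewrite coefCM coefXn eq_sym.
by case: eqP; rewrite ?mulr1 ?mulr0.
Qed.
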